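(* For all $m,\ell\in\{1,\dots,p^q\}$ and $k\in\{0,\dots,p^q-1\}$ we have $$\dim\operatorname{Ext}^k(\Delta_m,\Delta_\ell)=\dim\operatorname{Ext}^k\left(\Delta_{\tilde m},\Delta_{\tilde\ell}\right),$$ where $\tilde\ell=p^q+1-m$ and $\tilde m=p^q+1-\ell$.
   Context: Let $p$ be a prime, $\mathbb F$ an algebraically closed field of characteristic $p$, and $q\ge 2$ a fixed natural number. Consider a block of polynomial representations of $GL_2(\mathbb F)$ with $p^q$ simple modules (all such blocks are equivalent), and let $\Delta_1,\dots,\Delta_{p^q}$ be its Weyl (= standard) modules, numbered according to the total order on the highest weights in the block. $\operatorname{Ext}^k$ denotes the $k$-th extension group over $\mathbb F$. Known description used throughout (Miemietz--Turner): $\operatorname{Ext}^k(\Delta_m,\Delta_\ell)$ has a basis indexed by the finite set $\mathcal B^k(m,\ell)$, so $\dim\operatorname{Ext}^k(\Delta_m,\Delta_\ell)=\sharp\mathcal B^k(m,\ell)$, where $\mathcal B^k(m,\ell)$ is defined as follows. Put $\mathcal P_{\mathfrak c}=\{(s,x,y,t)\in\mathbb Z^4: 1\le s\le t\le p,\ 0\le x+y\le 1,\ t-s=x+2y,\ \text{and } x=y=0\text{ if }s=t\}$; $\mathcal P_0=\{(s,0,0,t)\in\mathbb Z^4: 1\le s,t\le p,\ s+t=p+1\}\setminus\{(p,0,0,1)\}$; $\mathcal P_M=\{(s,x,y,t)\in\mathbb Z^4: 1\le s,t\le p,\ x+2y+2=t-1-s+p,\ 0\le x+y+2\le 1\}$;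 $\mathcal P_{\overline M}=\mathcal P_M\setminus\{(p,0,-1,1)\}$. Let $\mathcal M$ be the set of $(s,x,y,a,b,t)\in\mathbb Z^6$ with $a,b\ge 0$ such that one of the following holds: $a=b$ and $(s,x,y,t)\in\mathcal P_{\mathfrak c}$; or $a=b-1$ and $(s,x,y,t)\in\mathcal P_0$; or $a=b+1$ and $(s,x,y,t)\in\mathcal P_{\overline M}$; or $a>b+1$ and $(s,x,y,t)\in\mathcal P_M$. To such an element associate $i=-a-b$; $j=x-(a-b-1)p+1$ if $a\ge b+1$, $j=x$ if $a=b$, $j=x+1$ if $a=b-1$; and $k=y+(a-b-1)(p-1)$ if $a\ge b+1$, $k=y$ if $a\le b$. Let $\mathcal P_{\Upsilon^{\le 0}}$ be the set of all resulting $(s,i,j,k,a,b,t)\in\mathbb Z^7$, and $\mathcal P_{\Upsilon^{\le 1}}=\mathcal P_{\Upsilon^{\le 0}}\cup\{(s,1,1,0,0,0,p+1-s):1\le s\le p\}$. For $1\le m,\ell\le p^q$ let $s_g,t_g\in\{1,\dots,p\}$ $(1\le g\le q)$ be the unique numbers with $m-1=\sum_{g=1}^q(s_g-1)p^{q-g}$ and $\ell-1=\sum_{g=1}^q(t_g-1)p^{q-g}$. For $k\in\mathbb Z$, $\mathcal B^k(m,\ell)$ is the set of $q$-tuples $(\mathbf v_1,\dots,\mathbf v_q)$ with $\mathbf v_g=(s_g,i_g,j_g,k_g,a_g,b_g,t_g)\in\mathcal P_{\Upsilon^{\le 1}}$ for all $g$, $i_1=0$, $i_g=j_{g-1}$ for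 $2\le g\le q$, and $k_1+\dots+k_q=k$. *)

(* Defs.v *)
From HB Require Import structures.
From mathcomp Require Import all_boot all_order all_algebra.
From mathcomp Require Import mpoly.
From Stdlib Require Import Relations.Relation_Operators.

Set Implicit Arguments.
Unset Strict Implicit.
Unset Printing Implicit Defensive.

Import Order.TTheory GRing.Theory Num.Theory.
Local Open Scope ring_scope.

Section Representations.
Variable F : fieldType.

(* Elements of GL_2(F)^k are families of 2 x 2 matrices satisfying [inGL].
   Functions on GL_2(F)^k are represented by functions on all families of
   2 x 2 matrices, whose values outside GL_2(F)^k are irrelevant. *)
Definition gl2fam (k : nat) := {ffun 'I_k -> 'M[F]_2}.

Definition inGL k (g : gl2fam k) : Prop := forall i, g i \in unitmx.

(* A polynomial in the 4k matrix entries; the inverse of the determinant is not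
   allowed. *)
Definition polynomial_fun k (f : gl2fam k -> F) : Prop :=
  exists P : {mpoly F[#|{: 'I_k * 'I_2 * 'I_2}|]}, forall g, inGL g ->
    f g = P.@[fun v => let: (l, a, b) := enum_val v in g l a b].

(* [act g] is the matrix of g acting on column vectors F^dim. *)
Record rep := Rep { rdim : nat; act : 'M[F]_2 -> 'M[F]_rdim }.

Definition polynomial_rep (M : rep) : Prop :=
  [/\ act M 1%:M = 1%:M,
      forall g h, g \in unitmx -> h \in unitmx ->
        act M (g *m h) = act M g *m act M h
    & forall i j, polynomial_fun (fun g : gl2fam 1 => act M (g ord0) i j)].

(* A subspace is given as the column space of a square matrix U. *)
Definition simple_rep (M : rep) : Prop :=
  [/\ polynomial_rep M, (0 < rdim M)%N &
      forall U : 'M[F]_(rdim M),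
        (forall g, g \in unitmx -> exists X : 'M_(rdim M), act M g *m U = U *m X) ->
        U = 0 \/ U \in unitmx].

Definition iso_rep (M N : rep) : Prop :=
  exists (A : 'M[F]_(rdim N, rdim M)) (B : 'M[F]_(rdim M, rdim N)),
    [/\ B *m A = 1%:M, A *m B = 1%:M &
        forall g, g \in unitmx -> A *m act M g = act N g *m A].

(* Extension groups in the category of polynomial representations, that is of
   finite-dimensional comodules over the coalgebra F[M_2] of polynomial functions
   on GL_2(F): they are computed by the cobar complex, whose k-cochains
   Hom(M, N) (x) F[M_2]^(x)k are the polynomial functions
   GL_2(F)^k -> Hom_F(M, N), with the differential of inhomogeneous group
   cochains. *)
Definition cochain (M N : rep) (k : nat) := gl2fam k -> 'M[F]_(rdim N, rdim M).

Definition polynomial_cochain M N k (c : cochain M N k) : Prop :=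
  forall i j, polynomial_fun (fun g => c g i j).

Definition face_first k (g : gl2fam k.+1) : gl2fam k :=
  [ffun i => g (lift ord0 i)].

Definition face_last k (g : gl2fam k.+1) : gl2fam k :=
  [ffun i => g (widen_ord (leqnSn k) i)].

Definition face_mul k (l : 'I_k) (g : gl2fam k.+1) : gl2fam k :=
  [ffun i : 'I_k => if (i < l)%N then g (widen_ord (leqnSn k) i)
             else if i == l then g (widen_ord (leqnSn k) i) *m g (lift ord0 i)
             else g (lift ord0 i)].

Definition differential M N k (c : cochain M N k) : cochain M N k.+1 :=
  fun g => act N (g ord0) *m c (face_first g)
           + \sum_(l < k) (-1) ^+ l.+1 *: c (face_mul l g)
           + (-1) ^+ k.+1 *: (c (face_last g) *m act M (g ord_max)).

Definition cocycle M N k (c : cochain M N k) : Prop :=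
  polynomial_cochain c /\ forall g, inGL g -> differential c g = 0.

Definition coboundary M N k : cochain M N k -> Prop :=
  match k with
  | 0 => fun c => forall g, inGL g -> c g = 0
  | k'.+1 => fun c => exists2 b : cochain M N k',
      polynomial_cochain b & forall g, inGL g -> c g = differential b g
  end.

(* dim_F Ext^k(M, N) = d: the classes of some d cocycles form a basis of the
   space of cocycles modulo coboundaries. *)
Definition dim_Ext (k : nat) (M N : rep) (d : nat) : Prop :=
  exists z : 'I_d -> cochain M N k,
    (forall i, cocycle (z i)) /\
    (forall c, cocycle c ->
       exists! a : 'rV[F]_d, coboundary (fun g => c g - \sum_i a 0 i *: z i g)).

Definition linked_step (L L' : rep) : Prop :=
  [/\ simple_rep L, simple_rep L' & iso_rep L L' \/ ~ dim_Ext 1 L L' 0].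

(* L and L' belong to the same block *)
Definition linked : rep -> rep -> Prop := clos_refl_sym_trans rep linked_step.

(* M has a highest weight vector v of weight lam = (lam_1, lam_2): upper triangular
   matrices act on it by g_11^lam_1 g_22^lam_2. *)
Definition highest_weight (M : rep) (lam : nat * nat) : Prop :=
  exists2 v : 'cV[F]_(rdim M), v != 0 &
    forall g, g \in unitmx -> g 1 0 = 0 ->
      act M g *m v = (g 0 0 ^+ lam.1 * g 1 1 ^+ lam.2) *: v.

(* The Weyl module det^lam_2 (x) D^n(F^2), n = lam_1 - lam_2, where the divided
   power D^n is the contravariant (transpose) dual of Sym^n: with e_0 = 1, e_1 = X
   and the basis e_0^(n-i) e_1^i, the matrix of g on Sym^n has as column i the
   coefficients of (g_00 + g_10 X)^(n-i) (g_01 + g_11 X)^i, and the matrix of g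
   on D^n is the transpose of the one of g^T on Sym^n. *)
Definition weyl (lam : nat * nat) : rep :=
  let n := (lam.1 - lam.2)%N in
  Rep (fun g : 'M[F]_2 => \det g ^+ lam.2 *:
    \matrix_(i < n.+1, j < n.+1)
      (((g 0 0)%:P + g 0 1 *: 'X) ^+ (n - i)
       * ((g 1 0)%:P + g 1 1 *: 'X) ^+ i)`_j).

(* lam 1, ..., lam N are the highest weights of the simple modules of a block with
   N simple modules up to isomorphism, in increasing order. All weights of a block
   have the same degree lam_1 + lam_2, so that lam_1 determines their order; simple
   modules with distinct highest weights are not isomorphic. *)
Definition block_weights (N : nat) (lam : nat -> nat * nat) : Prop :=
  exists L : nat -> rep,
    [/\ forall i, (1 <= i <= N)%N -> simple_rep (L i),
        forall i, (1 <= i <= N)%N -> highest_weight (L i) (lam i),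
        forall i j, (1 <= i)%N -> (i < j)%N -> (j <= N)%N ->
          ((lam i).1 < (lam j).1)%N
      & forall i M, (1 <= i <= N)%N -> simple_rep M ->
          (linked (L i) M <-> exists2 j, (1 <= j <= N)%N & iso_rep (L j) M)].

End Representations.

Arguments weyl F lam : clear implicits.
Arguments block_weights F N lam : clear implicits.

Section Combinatorics.
Variable p : nat.
Implicit Types s x y i j k a b t : int.

Definition inPc s x y t : bool :=
  [&& 1 <= s, s <= t, t <= p%:Z, 0 <= x + y <= 1, t - s == x + 2 * y
    & (s == t) ==> (x == 0) && (y == 0)].

Definition inP0 s x y t : bool :=
  [&& 1 <= s <= p%:Z, 1 <= t <= p%:Z, x == 0, y == 0, s + t == p%:Z + 1
    & (s, x, y, t) != (p%:Z, 0, 0, 1)].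

Definition inPM s x y t : bool :=
  [&& 1 <= s <= p%:Z, 1 <= t <= p%:Z, x + 2 * y + 2 == t - 1 - s + p%:Z
    & 0 <= x + y + 2 <= 1].

Definition inPMbar s x y t : bool :=
  inPM s x y t && ((s, x, y, t) != (p%:Z, 0, -1, 1)).

Definition inM s x y a b t : bool :=
  [&& 0 <= a, 0 <= b &
    [|| (a == b) && inPc s x y t,
        (a == b - 1) && inP0 s x y t,
        (a == b + 1) && inPMbar s x y t
      | (a > b + 1) && inPM s x y t]].

Definition idx_i a b : int := - a - b.

Definition idx_j x a b : int :=
  if a >= b + 1 then x - (a - b - 1) * p%:Z + 1
  else if a == b then x else x + 1.

Definition idx_k y a b : int :=
  if a >= b + 1 then y + (a - b - 1) * (p%:Z - 1) else y.

Record vec7 := Vec7 { vs : int; vi : int; vj : int; vk : int;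
                      va : int; vb : int; vt : int }.

Definition vec7_tuple (v : vec7) :=
  (vs v, vi v, vj v, vk v, va v, vb v, vt v).

Definition tuple_vec7 (u : int * int * int * int * int * int * int) :=
  let: (s, i, j, k, a, b, t) := u in Vec7 s i j k a b t.

Lemma vec7_tupleK : cancel vec7_tuple tuple_vec7.
Proof. by case. Qed.

HB.instance Definition _ := Equality.copy vec7 (can_type vec7_tupleK).

Definition inUpsilon0 (v : vec7) : Prop :=
  exists x y, inM (vs v) x y (va v) (vb v) (vt v) /\
    [/\ vi v = idx_i (va v) (vb v), vj v = idx_j x (va v) (vb v)
      & vk v = idx_k y (va v) (vb v)].

Definition inUpsilon1 (v : vec7) : Prop :=
  inUpsilon0 v \/
  exists s, 1 <= s <= p%:Z /\ v = Vec7 s 1 1 0 0 0 (p%:Z + 1 - s).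

(* The set B^k(m, l). Positions are numbered from 0, so that position g carries the
   weight p^(q-1-g); the first two sums say that the entries s and t of the v_g are
   the base p digits, increased by 1, of m - 1 and l - 1. *)
Definition inB (q : nat) (k : int) (m l : nat) (v : q.-tuple vec7) : Prop :=
  [/\ forall g, inUpsilon1 (tnth v g),
      \sum_(g < q) (vs (tnth v g) - 1) * p%:Z ^+ (q - 1 - g) = m%:Z - 1
        /\ \sum_(g < q) (vt (tnth v g) - 1) * p%:Z ^+ (q - 1 - g) = l%:Z - 1,
      forall g : 'I_q, g = 0%N :> nat -> vi (tnth v g) = 0,
      forall g h : 'I_q, h = g.+1 :> nat -> vi (tnth v h) = vj (tnth v g)
    & \sum_(g < q) vk (tnth v g) = k].

End Combinatorics.

(* The Miemietz--Turner description, for a block with highest weights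
   lam 1, ..., lam (p^q) in increasing order: Ext^k between Weyl modules has a basis indexed by the
   finite set B^k(m, l), here enumerated without repetition by e. *)
Definition dim_Ext_eq_card_B
    (F : fieldType) (p q : nat) (lam : nat -> nat * nat) : Prop :=
  forall k m l : nat, (1 <= m <= p ^ q)%N -> (1 <= l <= p ^ q)%N ->
  exists e : seq (q.-tuple vec7),
    [/\ uniq e, forall v, v \in e <-> inB p k m l v
      & dim_Ext k (weyl F (lam m)) (weyl F (lam l)) (size e)].

(* Main.v *)
Require Import Defs.
From mathcomp Require Import all_boot all_order all_algebra.
From mathcomp Require Import zify.

Import GRing.Theory.
Local Open Scope ring_scope.

(** Replacing every base [p] digit [d] of [m - 1] by [p - 1 - d] gives the digits
of [p ^ q - m].  All the conditions on the 7-tuples involve [s] and [t] only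
through [t - s], through the relation [s + t = p + 1], or through the excluded
pair [(s, t) = (p, 1)], and these are invariant under
[(s, t) |-> (p + 1 - t, p + 1 - s)].  Applying this involution to each component
is therefore a bijection between the two bases. *)

Section Flip.
Variable p : nat.

Definition flip (v : vec7) : vec7 :=
  let: Vec7 s i j k a b t := v in
  Vec7 (p%:Z + 1 - t) i j k a b (p%:Z + 1 - s).

Lemma flipK : involutive flip.
Proof. by case=> s i j k a b t /=; rewrite !subKr. Qed.

Lemma inM_flip s x y a b t :
  inM p s x y a b t -> inM p (p%:Z + 1 - t) x y a b (p%:Z + 1 - s).
Proof.
rewrite /inM /inPMbar /inPc /inP0 /inPM !xpair_eqE.
(* [a] and [b] are untouched, so each of the four cases is sent to itself and leaves linear
   arithmetic in [s], [x], [y], [t]. *)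
by case/and3P=> -> -> /= /or4P[]/andP[-> H]; apply/or4P;
  [apply: Or41 | apply: Or42 | apply: Or43 | apply: Or44]; lia.
Qed.

Lemma inUpsilon1_flip v : inUpsilon1 p v -> inUpsilon1 p (flip v).
Proof.
case: v => s i j k a b t [[x [y [hM hijk]]]|[s0 [hs0 [-> -> -> -> -> -> ->]]]].
  by left; exists x, y; split; first exact: inM_flip.
(* The additional vectors satisfy [s + t = p + 1], so [flip] fixes them and the same witness
   serves. *)
by right; exists s0; rewrite /= subKr.
Qed.

(** A geometric sum, once [rev_ord] has put the exponents in increasing order. *)
Lemma sum_top_digits (q : nat) :
  \sum_(g < q) (p%:Z - 1) * p%:Z ^+ (q - 1 - g) = (p ^ q)%N%:Z - 1.
Proof.
rewrite -mulr_sumr -[in RHS]natz natrX natz subrX1; congr (_ * _).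
rewrite (reindex_inj rev_ord_inj) /=; apply: eq_bigr => g _.
by congr (_ ^+ _); have := ltn_ord g; lia.
Qed.

(** Complementing digits subtracts termwise from the expansion with all digits [p - 1]; the bound on
    [n] keeps the natural subtraction exact. *)
Lemma sum_flip_digits (q n : nat) (d : 'I_q -> int) : (n <= p ^ q)%N ->
    \sum_g (d g - 1) * p%:Z ^+ (q - 1 - g) = n%:Z - 1 ->
  \sum_g (p%:Z + 1 - d g - 1) * p%:Z ^+ (q - 1 - g)
    = (p ^ q + 1 - n)%N%:Z - 1.
Proof.
move=> le_n sum_d.
transitivity (((p ^ q)%N%:Z - 1) - (n%:Z - 1)); last by lia.
rewrite -sum_top_digits -sum_d -sumrB; apply: eq_bigr => g _.
by rewrite -mulrBl; congr (_ * _); lia.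
Qed.

Lemma inB_flip (q : nat) (k : int) (m l : nat) (v : q.-tuple vec7) :
    (m <= p ^ q)%N -> (l <= p ^ q)%N -> inB p k m l v ->
  inB p k (p ^ q + 1 - l) (p ^ q + 1 - m) [tuple of map flip v].
Proof.
move=> le_m le_l [inU [sum_s sum_t] i0 ij sum_k].
have vsE u : vs (flip u) = p%:Z + 1 - vt u by case: u.
have vtE u : vt (flip u) = p%:Z + 1 - vs u by case: u.
have viE u : vi (flip u) = vi u by case: u.
have vjE u : vj (flip u) = vj u by case: u.
have vkE u : vk (flip u) = vk u by case: u.
split=> [g||g g0|g h hg|].
- by rewrite tnth_map; apply: inUpsilon1_flip.
(* [flip] also exchanges the roles of [s] and [t]: the new [s] digits complement those of [l], the
   new [t] digits those of [m]. *)
- split.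
    rewrite -(sum_flip_digits _ _ _ le_l sum_t).
    by apply: eq_bigr => g _; rewrite tnth_map vsE.
  rewrite -(sum_flip_digits _ _ _ le_m sum_s).
  by apply: eq_bigr => g _; rewrite tnth_map vtE.
- by rewrite tnth_map viE i0.
- by rewrite !tnth_map viE vjE (ij g).
- by rewrite -sum_k; apply: eq_bigr => g _; rewrite tnth_map vkE.
Qed.

(** Componentwise [flip] is an involution on tuples, hence injective, and so embeds [e] into
    [e']. *)
Lemma size_inB_flip (q : nat) (k : int) (m l : nat) (e e' : seq (q.-tuple vec7)) :
    (m <= p ^ q)%N -> (l <= p ^ q)%N -> uniq e ->
    (forall v, v \in e <-> inB p k m l v) ->
    (forall v, v \in e' <-> inB p k (p ^ q + 1 - l) (p ^ q + 1 - m) v) ->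
  (size e <= size e')%N.
Proof.
move=> le_m le_l uniq_e eP e'P.
pose flips (v : q.-tuple vec7) := [tuple of map flip v].
have flips_inj : injective flips.
  apply: inv_inj => v; apply: val_inj => /=.
  by rewrite -map_comp map_id_in // => u _; exact: flipK.
rewrite -(size_map flips); apply: uniq_leq_size; first by rewrite map_inj_uniq.
by move=> _ /mapP[v /eP Bv ->]; apply/e'P; apply: inB_flip.
Qed.

End Flip.

Theorem theorem7 (F : closedFieldType) (p q : nat) (lam : nat -> nat * nat)
    (charF : p \in [pchar F])
    (q_ge2 : (2 <= q)%N)
    (block : block_weights F (p ^ q) lam)
    (MiemietzTurner : dim_Ext_eq_card_B F p q lam)
    (m l k : nat)
    (m_range : (1 <= m <= p ^ q)%N)
    (l_range : (1 <= l <= p ^ q)%N)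
    (k_range : (k <= p ^ q - 1)%N)
    (m' l' : nat)
    (def_l' : l' = (p ^ q + 1 - m)%N)
    (def_m' : m' = (p ^ q + 1 - l)%N) :
  exists2 d : nat,
    dim_Ext k (weyl F (lam m)) (weyl F (lam l)) d &
    dim_Ext k (weyl F (lam m')) (weyl F (lam l')) d.
Proof.
(* Generalizing [p ^ q] to [N] makes the goal linear. *)
have m'_range : (1 <= m' <= p ^ q)%N by move: (p ^ q)%N l_range def_m' => N; lia.
have l'_range : (1 <= l' <= p ^ q)%N by move: (p ^ q)%N m_range def_l' => N; lia.
have [e [uniq_e eP dim_e]] := MiemietzTurner k m l m_range l_range.
have [e' [uniq_e' e'P dim_e']] := MiemietzTurner k m' l' m'_range l'_range.
have [/andP[_ le_m] /andP[_ le_l]] := (m_range, l_range).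
have [/andP[_ le_m'] /andP[_ le_l']] := (m'_range, l'_range).
exists (size e) => //; suff -> : size e = size e' by [].
(* The passage from [(m, l)] to [(m', l')] is itself an involution, so the same inequality applied
   to [(m', l')] gives the converse bound. *)
have m'K : (p ^ q + 1 - l')%N = m by move: (p ^ q)%N m_range def_l' => N; lia.
have l'K : (p ^ q + 1 - m')%N = l by move: (p ^ q)%N l_range def_m' => N; lia.
apply/eqP; rewrite eqn_leq; apply/andP; split.
  by apply: (size_inB_flip _ _ _ _ _ _ _ le_m le_l) => // v; rewrite -def_l' -def_m'.
by apply: (size_inB_flip _ _ _ _ _ _ _ le_m' le_l') => // v; rewrite m'K l'K.
Qed.
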